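(* Let $k,m$ be positive integers with $k<m<2k$, and for $n\ge 0$ let $\bar{h}(m,n)$ denote the number of tilings of an $m\times n\times k$ cuboid with $k\times k\times 1$ bricks. Then, as formal power series in $x$, $$\sum_{n\geq 0}\bar{h}(m,n)x^n=\frac{(1-2x^k)^{k-1}}{(1-2x^k)^{k-1}\left[1-(m-k+2)x^k\right]-(m-k+1)x^k}.$$
   Context: The cuboid is divided into unit cubical cells. A tiling of the $m\times n\times k$ cuboid with $k\times k\times 1$ bricks is a partition of its cells into bricks, each of which is an axis-parallel box of cells with side lengths $k,k,1$ in some order; all three axis-parallel orientations are allowed. Tilings are counted as distinct configurations (not up to symmetry). Convention: $\bar h(m,0)=1$ (the empty tiling). *)

(* Defs.v *)
From mathcomp Require Import all_boot all_order all_algebra.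
Set Implicit Arguments.
Unset Strict Implicit.
Unset Printing Implicit Defensive.
Import GRing.Theory.

Notation cell a b c := ('I_a * 'I_b * 'I_c)%type.

Section Tilings.
Local Open Scope nat_scope.

Variables a b c : nat.

(* The cells of the box with lowest corner o and side lengths d, truncated to
   the cuboid; [fits o d] says that nothing is cut off. *)
Definition box (o : cell a b c) (d : nat * nat * nat) : {set cell a b c} :=
  [set x : cell a b c | [&& o.1.1 <= x.1.1 < o.1.1 + d.1.1,
                            o.1.2 <= x.1.2 < o.1.2 + d.1.2
                          & o.2 <= x.2 < o.2 + d.2]].

Definition fits (o : cell a b c) (d : nat * nat * nat) : bool :=
  [&& o.1.1 + d.1.1 <= a, o.1.2 + d.1.2 <= b & o.2 + d.2 <= c].

Definition brick_dims (k : nat) : seq (nat * nat * nat) :=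
  [:: (k, k, 1); (k, 1, k); (1, k, k)].

Definition is_brick (k : nat) (B : {set cell a b c}) : bool :=
  has (fun d => [exists o : cell a b c, fits o d && (B == box o d)])
      (brick_dims k).

Definition is_tiling (k : nat) (P : {set {set cell a b c}}) : bool :=
  partition P [set: cell a b c] && [forall B in P, is_brick k B].

End Tilings.

Definition hbar (k m n : nat) : nat :=
  #|[set P : {set {set cell m n k}} | is_tiling k P]|.

Section PowerSeries.
Local Open Scope ring_scope.
Variable R : comUnitRingType.

(* A formal power series is its sequence of coefficients; equality of series
   is pointwise equality [=1]. *)
Definition fps : Type := nat -> R.

Definition fps_poly (p : {poly R}) : fps := fun n => p`_n.

Definition fps_mul (f g : fps) : fps :=
  fun n => \sum_(i < n.+1) f i * g (n - i)%N.

(* The first n coefficients of 1 / f: solve sum_(i <= n) f_(n-i) g_i = [n = 0]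
   successively for g_0, g_1, ... *)
Fixpoint fps_inv_prefix (f : fps) (n : nat) : seq R :=
  if n is n'.+1 then
    let s := fps_inv_prefix f n' in
    rcons s ((f 0%N)^-1 *
             ((n' == 0%N)%:R - \sum_(i < n') f (n' - i)%N * s`_i))
  else [::].

Definition fps_inv (f : fps) : fps := fun n => (fps_inv_prefix f n.+1)`_n.

Definition fps_div (f g : fps) : fps := fps_mul f (fps_inv g).

Lemma size_fps_inv_prefix (f : fps) n : size (fps_inv_prefix f n) = n.
Proof. by elim: n => //= n IHn; rewrite size_rcons IHn. Qed.

Lemma nth_fps_inv_prefix (f : fps) n i :
  (i < n)%N -> (fps_inv_prefix f n)`_i = fps_inv f i.
Proof.
elim: n => // n IHn; rewrite ltnS leq_eqVlt => /predU1P[-> // | lt_in].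
by rewrite /= nth_rcons size_fps_inv_prefix lt_in IHn.
Qed.

Lemma fps_mulfV (f : fps) :
  f 0%N \is a GRing.unit -> fps_mul f (fps_inv f) =1 fps_poly 1.
Proof.
move=> f0U n; rewrite /fps_poly coef1 /fps_mul big_ord_recl /= subn0.
rewrite {1}/fps_inv /= nth_rcons size_fps_inv_prefix ltnn eqxx mulVKr //.
rewrite (reindex_inj rev_ord_inj) /= -addrA [X in _ + X](_ : _ = 0) ?addr0 //.
rewrite addrC; apply/eqP; rewrite subr_eq0; apply/eqP; apply: eq_bigr => i _.
by rewrite nth_fps_inv_prefix ?subKn // rev_ord_proof.
Qed.

End PowerSeries.

(* Main.v *)
Require Import Defs.
From mathcomp Require Import all_boot all_order all_algebra.
From mathcomp Require Import zify ring.
Set Implicit Arguments.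
Unset Strict Implicit.
Unset Printing Implicit Defensive.
Import GRing.Theory.

(* Fill the cuboid slice by slice along its second axis, of length n.  As
   m < 2k, two bricks of length k in the first direction cannot lie side by
   side, so a slice either consists of walls (1,k,k) only, or has one window
   of columns [p, p + k), filled by a front (k,1,k) or by k plates (k,k,1), and
   walls elsewhere.  After the first slices have been filled the unfilled
   region is thus described by a level y, an excess e < k and a window p: it
   starts at y in the window and at y + e outside.  For e > 0 one continues
   with a front in the window (e decreases by 1), or with plates or walls in
   the window, and then walls of length k are forced outside it (e is
   unchanged).  For e = 0 one puts walls everywhere, or chooses one of the
   m - k + 1 windows and fills it with plates, or with a front, which leads to
   e = k - 1.  With t = x^k the generating functions T_e therefore satisfy
   (1 - 2t) T_e = T_(e-1) and (1 - (m-k+2)t) T_0 = 1 + (m-k+1) t T_(k-1). *)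

Local Open Scope nat_scope.

(** * Tilings of a finite set *)

Section ExactCovers.

Variables (T : finType) (tile : pred {set T}).

(** [is_tiling] for an arbitrary region, so that the rest of a partly filled cuboid can be tiled in
    turn. *)
Definition tilings (D : {set T}) : {set {set {set T}}} :=
  [set P | partition P D && [forall B in P, tile B]].

Lemma tilingsP D P :
  reflect (partition P D /\ {in P, forall B, tile B}) (P \in tilings D).
Proof.
by rewrite inE; apply: (iffP andP) => -[? /forall_inP].
Qed.

Lemma tilings_cover D P x :
  P \in tilings D -> x \in D -> exists2 B, B \in P & x \in B.
Proof.
by case/tilingsP=> /and3P[/eqP <- _ _] _ /bigcupP[B PB Bx]; exists B.
Qed.

Lemma tilings_tile D P B : P \in tilings D -> B \in P -> tile B.
Proof. by case/tilingsP=> _ tP /tP. Qed.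

Lemma tilings_sub D P B : P \in tilings D -> B \in P -> B \subset D.
Proof. by case/tilingsP=> /and3P[/eqP <- _ _] _ PB; apply: bigcup_sup. Qed.

Lemma tilings_eq D P B C x : P \in tilings D ->
  B \in P -> C \in P -> x \in B -> x \in C -> B = C.
Proof.
case/tilingsP=> /and3P[_ tP _] _ PB PC Bx Cx.
by rewrite -(def_pblock tP PB Bx) (def_pblock tP PC Cx).
Qed.

Lemma card_tilings0 : #|tilings set0| = 1.
Proof.
apply/eqP/cards1P; exists set0; apply/setP=> P; rewrite in_set1.
apply/tilingsP/eqP => [[] | ->]; first by rewrite partition_set0 => /eqP.
by rewrite partition_set0 eqxx; split=> // B; rewrite in_set0.
Qed.

(** Adding [B] is a bijection from the tilings of [D'] to those of [D] containing [B]. The disjoint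
    union of [D'] and [B] is written as a sum of indicators, a form that iterates along lists and
    suits [lia]. *)
Lemma card_tilings_tile (D D' B : {set T}) (Q : seq {set T}) : tile B -> B != set0 ->
    (forall x, (x \in D : nat) = (x \in D') + (x \in B)) -> B \notin Q ->
  #|[set P in tilings D | all (mem P) (B :: Q)]|
    = #|[set P in tilings D' | all (mem P) Q]|.
Proof.
move=> tB nzB DE nQB.
have DU : D = B :|: D'.
  by apply/setP=> x; rewrite inE; move: (DE x); do 3!case: (x \in _).
have dis : [disjoint B & D'].
  apply/pred0P=> x /=; move: (DE x); by do 3!case: (x \in _).
have D'E : D' = D :\: B.
  by apply/setP=> x; rewrite inE; move: (DE x); do 3!case: (x \in _).
have nPB P : P \in tilings D' -> B \notin P.
  move=> tP; apply/negP=> /(tilings_sub tP) sBD'.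
  case/set0Pn: nzB => x Bx; have := subsetP sBD' x Bx.
  by rewrite (disjointFr dis Bx).
rewrite -[RHS](card_in_imset (f := fun P => B |: P)); last first.
  move=> P P' /setIdP[tP _] /setIdP[tP' _] /= eqP.
  by rewrite -(setU1K (nPB _ tP)) eqP setU1K ?nPB.
apply: eq_card => P; apply/setIdP/imsetP => [[tP] /= /andP[PB sQP]|].
  exists (P :\ B); last by rewrite setD1K.
  apply/setIdP; split.
    apply/tilingsP; split=> [|C /setD1P[_ PC]]; last exact: tilings_tile tP PC.
    by rewrite D'E partitionD1 //; case/tilingsP: tP.
  apply/allP=> C QC; have /= PC := allP sQP C QC; rewrite in_setD1 PC andbT.
  by apply: contraNneq nQB => <-.
case=> {}P /setIdP[tP sQP] ->; split.
  apply/tilingsP; split=> [|C /setU1P[-> // | PC]]; last exact: tilings_tile tP PC.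
  by rewrite DU partitionU1 //; case/tilingsP: tP.
by rewrite /= setU11; apply/allP=> C /(allP sQP) /= PC; rewrite in_setU1 PC orbT.
Qed.

(** Counting multiplicities makes the tiles of [Q] distinct, disjoint and contained in [D], so they
    can be removed one at a time. *)
Lemma card_tilings_tiles (D D' : {set T}) (Q : seq {set T}) : ~~ tile set0 -> all tile Q ->
    (forall x, (x \in D : nat) = (x \in D') + count (fun B : {set T} => x \in B) Q) ->
  #|[set P in tilings D | all (mem P) Q]| = #|tilings D'|.
Proof.
move=> ntile0; elim: Q D => [|B Q IHQ] D /= => [_ DE | /andP[tB tQ] DE].
  have -> : D = D' by apply/setP=> x; move: (DE x); do 2!case: (x \in _).
  by apply: eq_card => P; rewrite inE andbT.
have nzB : B != set0 by apply: contraNneq ntile0 => <-.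
have sBD x : x \in B -> x \in D by move=> Bx; move: (DE x); rewrite Bx; lia.
rewrite (@card_tilings_tile _ (D :\: B)) //.
- apply: IHQ => // x; move: (DE x) (sBD x); rewrite inE.
  by case: (x \in B) => /= [DEx /(_ isT) Dx | DEx _]; rewrite ?Dx in DEx *; lia.
- by move=> x; move: (sBD x); rewrite inE; case: (x \in B) => /= [/(_ isT) -> | _]; lia.
(* A second copy of [B] in the list would count a point of [B] at least twice, but an indicator is
   at most 1. *)
apply/negP=> QB; case/set0Pn: nzB => x Bx; move: (DE x); rewrite Bx.
suff : 0 < count (fun C : {set T} => x \in C) Q by move=> ? ?; lia.
by rewrite -has_count; apply/hasP; exists B.
Qed.

(* The tiles [hd i] all contain [x], so a tiling contains [Q i] for at most one
   [i] with [f i]. *)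
Lemma card_tilings_split (D : {set T}) (I : finType) (f : pred I) (Q : I -> seq {set T})
    (D' : I -> {set T}) (hd : I -> {set T}) x :
    ~~ tile set0 -> {in f &, injective hd} ->
    (forall i, f i -> hd i \in Q i) -> (forall i, f i -> x \in hd i) ->
    (forall i, f i -> all tile (Q i)) ->
    (forall i, f i -> forall y, (y \in D : nat)
       = (y \in D' i) + count (fun B : {set T} => y \in B) (Q i)) ->
    (forall P, P \in tilings D -> exists2 i, f i & {subset Q i <= P}) ->
  #|tilings D| = \sum_(i | f i) #|tilings (D' i)|.
Proof.
move=> ntile0 hdI Qhd hdx tQ DE exQ.
transitivity (\sum_(i | f i) \sum_(P in tilings D | all (mem P) (Q i)) 1);
  last first.
  apply: eq_bigr => i fi; rewrite sum1_card.
  rewrite -(card_tilings_tiles ntile0 (tQ i fi) (DE i fi)).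
  by apply: eq_card => P; rewrite [RHS]in_set.
(* Double counting of the pairs of an index and a tiling: each tiling belongs to exactly one
   index. *)
rewrite -[LHS]sum1_card (exchange_big_dep (mem (tilings D))) /=; last first.
  by move=> i P _ /andP[].
apply: eq_bigr => P tP; have [i fi sQP] := exQ P tP.
rewrite (big_pred1 i) // => j /=; rewrite tP /=.
apply/andP/eqP=> [[fj /allP/= sQjP] | -> ]; last by split=> //; apply/allP=> B /sQP.
apply: hdI => //; apply: (tilings_eq tP (x := x)); try exact: hdx.
  by apply: sQjP; apply: Qhd.
by apply: sQP; apply: Qhd.
Qed.

End ExactCovers.

(** * Bricks and unfilled regions *)

Section Bricks.

Variables m n k : nat.

Definition region (d : nat -> nat -> nat -> bool) : {set cell m n k} :=
  [set c : cell m n k | d c.1.1 c.1.2 c.2].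

(* The three orientations of a brick with lowest corner (x, y, z); in the last
   two the brick has the full height [k] and z = 0. *)
Variant brick := BrickH of nat & nat & nat | BrickF of nat & nat | BrickW of nat & nat.

Definition in_brick (b : brick) (x y z : nat) : bool :=
  match b with
  | BrickH x0 y0 z0 => [&& x0 <= x < x0 + k, y0 <= y < y0 + k & z == z0]
  | BrickF x0 y0 => (x0 <= x < x0 + k) && (y == y0)
  | BrickW x0 y0 => (x == x0) && (y0 <= y < y0 + k)
  end.

Definition fits_brick (b : brick) : bool :=
  match b with
  | BrickH x y z => [&& x + k <= m, y + k <= n & z < k]
  | BrickF x y => (x + k <= m) && (y < n)
  | BrickW x y => (x < m) && (y + k <= n)
  end.

(* The bricks of [is_brick k] are the sets [brick_set b] with [fits_brick b];
   without [fits_brick b] the set is cut off at the faces of the cuboid. *)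
Definition brick_set (b : brick) : {set cell m n k} := region (in_brick b).

Lemma cellP x y z : x < m -> y < n -> z < k ->
  exists c : cell m n k, [/\ c.1.1 = x :> nat, c.1.2 = y :> nat & c.2 = z :> nat].
Proof. by move=> xm yn zk; exists (Ordinal xm, Ordinal yn, Ordinal zk). Qed.

Lemma is_brickP (B : {set cell m n k}) : 0 < k ->
  reflect (exists2 b, fits_brick b & B = brick_set b) (is_brick k B).
Proof.
move=> k_gt0; apply: (iffP hasP) => [[d + /existsP[[[x y] z] /andP[]]] | [b + ->]].
  rewrite !inE => /or3P[] /eqP-> /=; rewrite /fits /= => xyz /eqP->.
  - exists (BrickH x y z) => /=; first by case: x y z xyz => x ? [y ?] [z ?] /=; lia.
    by apply/setP=> -[[[a ?] [b ?]] [c ?]]; rewrite !inE /=; apply/idP/idP; lia.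
  - exists (BrickF x y) => /=; first by case: x y z xyz => x ? [y ?] [z ?] /=; lia.
    apply/setP=> -[[[a ?] [b ?]] [c ?]]; rewrite !inE /=.
    by case: x y z xyz => x ? [y ?] [z ?] /=; lia.
  - exists (BrickW x y) => /=; first by case: x y z xyz => x ? [y ?] [z ?] /=; lia.
    apply/setP=> -[[[a ?] [b ?]] [c ?]]; rewrite !inE /=.
    by case: x y z xyz => x ? [y ?] [z ?] /=; lia.
case: b => [x y z | x y | x y] /= xyz.
- have [||| o [ox oy oz]] := @cellP x y z; try lia.
  exists (k, k, 1); first by rewrite !inE eqxx.
  apply/existsP; exists o; rewrite /fits ox oy oz /=; apply/andP; split; first lia.
  apply/eqP/setP=> -[[[a ?] [b ?]] [c ?]]; rewrite !inE /= ox oy oz; lia.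
- have [||| o [ox oy oz]] := @cellP x y 0; try lia.
  exists (k, 1, k); first by rewrite !inE eqxx orbT.
  apply/existsP; exists o; rewrite /fits ox oy oz /=; apply/andP; split; first lia.
  apply/eqP/setP=> -[[[a ?] [b ?]] [c ?]]; rewrite !inE /= ox oy oz; lia.
have [||| o [ox oy oz]] := @cellP x y 0; try lia.
exists (1, k, k); first by rewrite !inE eqxx !orbT.
apply/existsP; exists o; rewrite /fits ox oy oz /=; apply/andP; split; first lia.
apply/eqP/setP=> -[[[a ?] [b ?]] [c ?]]; rewrite !inE /= ox oy oz; lia.
Qed.

Lemma is_brick0 : 0 < k -> ~~ is_brick k (set0 : {set cell m n k}).
Proof.
move=> k_gt0; apply/is_brickP => // -[b fb /setP E].
have [c] : exists c, c \in brick_set b; last by rewrite -E inE.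
by case: b fb {E} => [x y z | x y | x y] /= ?; [have [|||c [cx cy cz]] := @cellP x y z
  | have [|||c [cx cy cz]] := @cellP x y 0 | have [|||c [cx cy cz]] := @cellP x y 0];
  try lia; exists c; rewrite inE /= cx cy ?cz; lia.
Qed.

Section Tiling.

Variables (d : nat -> nat -> nat -> bool) (P : {set {set cell m n k}}).
Hypotheses (k_gt0 : 0 < k) (tP : P \in tilings (is_brick k) (region d)).

Lemma tiling_cover x y z : x < m -> y < n -> z < k -> d x y z ->
  exists b, [/\ fits_brick b, brick_set b \in P & in_brick b x y z].
Proof.
move=> xm yn zk dxyz; have [c [cx cy cz]] := cellP xm yn zk.
have [|B PB Bc] := tilings_cover tP (x := c); first by rewrite inE cx cy cz.
have /(is_brickP _ k_gt0)[b fb BE] := tilings_tile tP PB.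
by exists b; split=> //; move: PB Bc; rewrite BE // inE cx cy cz.
Qed.

Lemma tiling_sub b x y z : brick_set b \in P ->
  x < m -> y < n -> z < k -> in_brick b x y z -> d x y z.
Proof.
move=> Pb xm yn zk bxyz; have [c [cx cy cz]] := cellP xm yn zk.
have /subsetP/(_ c) := tilings_sub tP Pb.
by rewrite !inE cx cy cz; apply.
Qed.

(** Turns a clash of two bricks into arithmetic: one common cell makes them equal, and a cell of
    only one of them is then absurd. *)
Lemma tiling_agree x y z x' y' z' b b' : brick_set b \in P -> brick_set b' \in P ->
  x < m -> y < n -> z < k -> in_brick b x y z -> in_brick b' x y z ->
  x' < m -> y' < n -> z' < k -> in_brick b x' y' z' = in_brick b' x' y' z'.
Proof.
move=> Pb Pb' xm yn zk bc b'c xm' yn' zk'.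
have [c [cx cy cz]] := cellP xm yn zk; have [c' [cx' cy' cz']] := cellP xm' yn' zk'.
have /setP/(_ c') : brick_set b = brick_set b'.
  by apply: (tilings_eq tP Pb Pb' (x := c)); rewrite inE cx cy cz.
by rewrite !inE cx' cy' cz'.
Qed.

End Tiling.

End Bricks.

(** * Layers forced by a brick in the first unfilled slice of the window *)

Section Frontier.

Variables m n k : nat.
Hypotheses (k_gt1 : 1 < k) (lt_km : k < m) (lt_m2k : m < 2 * k).

Let k_gt0 : 0 < k := ltnW k_gt1.

Definition unfilled (p y e x y' _z : nat) : bool :=
  if p <= x < p + k then y <= y' else y + e <= y'.

Definition frontier p y e : {set cell m n k} := region m n k (unfilled p y e).

Definition outer_walls p y : seq brick :=
  [seq BrickW x y | x <- iota 0 m & ~~ (p <= x < p + k)].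

Definition wall_layer p y e : seq brick :=
  [seq BrickW x y | x <- iota p k] ++ outer_walls p (y + e).

Definition plate_layer p y e : seq brick :=
  [seq BrickH p y z | z <- iota 0 k] ++ outer_walls p (y + e).

(** Meant for excess 0, where a front forces walls outside from the same level; for positive excess
    a front is placed alone. *)
Definition front_layer p y : seq brick := BrickF p y :: outer_walls p y.

Section Tiling.

Variables (P : {set {set cell m n k}}) (p y e : nat).
Hypotheses (le_pm : p + k <= m) (lt_ek : e < k).
Hypothesis tP : P \in tilings (is_brick k) (frontier p y e).

Let PB b := brick_set m n k b \in P.

(** The window is filled below [y], so the brick starts at [y]. If [e > 0], the columns outside are
    still filled at level [y], so a brick of length [k] in the first direction must span exactly the
    window. *)
Lemma unfilled_slice_brick x z : p <= x < p + k -> y < n -> z < k ->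
  [\/ PB (BrickW x y) /\ y + k <= n,
      exists p', [/\ PB (BrickF p' y), p' <= x < p' + k, p' + k <= m & 0 < e -> p' = p]
    | exists p', [/\ PB (BrickH p' y z), p' <= x < p' + k,
        p' + k <= m, y + k <= n & 0 < e -> p' = p]].
Proof.
move=> px yn zk; have xm : x < m by lia.
have [|b [fb Pb bc]] := tiling_cover k_gt0 tP xm yn zk; first by rewrite /unfilled px leqnn.
have sub := tiling_sub tP Pb.
case: b fb Pb bc sub => [p' y' z' | p' y' | x' y'] /= fb Pb bc sub.
- have y'E : y' = y.
    by have := sub x y' z; rewrite /unfilled px; lia.
  have z'E : z' = z by lia.
  subst y' z'; apply: Or33; exists p'; split=> //; try lia.
  (* A brick shifted to the left or right covers a filled cell at its first or last column. *)
  move=> e0; case: (ltngtP p' p) => // lt.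
    by have := sub p' y z; rewrite /unfilled; case: ifP; lia.
  by have := sub (p' + k).-1 y z; rewrite /unfilled; case: ifP; lia.
- have y'E : y' = y by lia.
  subst y'; apply: Or32; exists p'; split=> //; try lia.
  move=> e0; case: (ltngtP p' p) => // lt.
    by have := sub p' y z; rewrite /unfilled; case: ifP; lia.
  by have := sub (p' + k).-1 y z; rewrite /unfilled; case: ifP; lia.
have y'E : y' = y.
  by have := sub x y' z; rewrite /unfilled px; lia.
have x'E : x' = x by lia.
by subst x' y'; apply: Or31; split=> //; lia.
Qed.


Lemma all_outer_walls (a : pred brick) q y' :
  (forall x, x < m -> ~~ (q <= x < q + k) -> a (BrickW x y')) -> all a (outer_walls q y').
Proof.
move=> aW; rewrite all_map; apply/allP=> x /=.
by rewrite mem_filter mem_iota => /andP[qx xm]; apply: aW => //; lia.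
Qed.

(** If the row at slice [y + e] and height [z] is covered in the window by bricks that stay inside
    it there, then only walls fit outside. *)
Lemma forced_outer_walls z : z < k -> y + e < n ->
    (forall x, p <= x < p + k -> exists b, [/\ PB b, in_brick k b x (y + e) z
       & forall x', ~~ (p <= x' < p + k) -> ~~ in_brick k b x' (y + e) z]) ->
  y + e + k <= n /\ all PB (outer_walls p (y + e)).
Proof.
move=> zk yn inner.
have walls x : x < m -> ~~ (p <= x < p + k) ->
    y + e + k <= n /\ PB (BrickW x (y + e)).
  move=> xm px.
  have [|b [fb Pb bc]] := tiling_cover k_gt0 tP xm yn zk.
    by rewrite /unfilled (negbTE px).
  (* As [m < 2 * k], two intervals of length [k] in the range share the column [maxn p p']. The
     brick covering it does not leave the window, so it cannot be the one reaching [x]. *)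
  have not_long p' : p' + k <= m -> p' <= x < p' + k ->
      (forall x', p' <= x' < p' + k -> in_brick k b x' (y + e) z) -> False.
    move=> p'm p'x bp'; have [|b' [Pb' b'c b'o]] := inner (maxn p p'); first lia.
    have /negP := b'o x px; apply.
    rewrite -(tiling_agree tP Pb Pb' _ yn zk _ b'c) //; first lia.
    by apply: bp'; lia.
  have sub := tiling_sub tP Pb xm.
  case: b fb Pb bc sub not_long => [p' y' z' | p' y' | x' y'] /= fb Pb bc sub not_long.
  - by case: (not_long p'); lia.
  - by case: (not_long p'); lia.
  have y'E : y' = y + e.
    by have := sub y' z; rewrite /unfilled (negbTE px); lia.
  have x'E : x' = x by lia.
  by subst x' y'; split=> //; lia.
split; last by apply: all_outer_walls => x xm px; case: (walls x xm px).
(* Since [k < m], some column lies outside the window: [k] if [p = 0], and [0] otherwise. *)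
case: (posnP p) => p0.
  by case: (walls k); lia.
by case: (walls 0); lia.
Qed.

Lemma tiling_walls : y < n -> (forall x, p <= x < p + k -> PB (BrickW x y)) -> y + k <= n ->
  y + e + k <= n /\ all PB (wall_layer p y e).
Proof.
move=> yn walls ykn; have [||//|le_n outer] := @forced_outer_walls 0; try lia.
  move=> x px; exists (BrickW x y); split; first exact: walls.
    by rewrite /=; lia.
  by move=> x' px' /=; lia.
split=> //; rewrite all_cat outer andbT all_map; apply/allP=> x.
by rewrite mem_iota => /walls.
Qed.

(** As [e < k], one plate already reaches slice [y + e] and forces the outer walls; these in turn
    keep the plates at all other heights in the same window. *)
Lemma tiling_plates z0 : z0 < k -> y + k <= n -> PB (BrickH p y z0) ->
  y + e + k <= n /\ all PB (plate_layer p y e).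
Proof.
move=> z0k ykn Pz0; have [||//|le_n outer] := @forced_outer_walls z0; try lia.
  move=> x px; exists (BrickH p y z0); split=> // [|x' px' /=]; first by rewrite /=; lia.
  lia.
split=> //; rewrite all_cat outer andbT all_map; apply/allP=> z; rewrite mem_iota /= => zk.
have pp : p <= p < p + k by lia.
have yn : y < n by lia.
have pm : p < m by lia.
have [[Pb _]|[p' [Pb p'p p'm _]]|[p' [Pb p'p p'm _ ep']]] := unfilled_slice_brick pp yn zk.
(* A wall or a front here has full height and would meet the given plate. *)
- have := tiling_agree tP Pb Pz0 (x := p) (y := y) (z := z0) (x' := p.+1) (y' := y) (z' := z0).
  by rewrite /=; lia.
- have := tiling_agree tP Pb Pz0 (x := p) (y := y) (z := z0) (x' := p) (y' := y) (z' := z).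
  case: (eqVneq z z0) => [-> // | ]; rewrite /=; lia.
case: (eqVneq p' p) => [<- // | neq].
(* A plate in another window starts at some [p' < p], where it hits a forced outer wall. *)
have e0 : e = 0 by case: posnP ep' neq => // _ ->; rewrite ?eqxx.
have p'W : PB (BrickW p' y).
  move: outer; rewrite all_map => /allP/(_ p'); rewrite mem_filter mem_iota e0 addn0.
  by apply; lia.
have := tiling_agree tP Pb p'W (x := p') (y := y) (z := z) (x' := p'.+1) (y' := y) (z' := z).
by rewrite /=; lia.
Qed.

Lemma tiling_fronts : e = 0 -> y < n -> PB (BrickF p y) ->
  y + k <= n /\ all PB (front_layer p y).
Proof.
move=> e0 yn PF; have [|||] := @forced_outer_walls 0; rewrite ?e0 ?addn0 //=.
  move=> x px; exists (BrickF p y); split=> //= [|x' px']; lia.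
by move=> -> ->; rewrite andbT.
Qed.

End Tiling.

Lemma frontier_0 p q y : frontier p y 0 = frontier q y 0.
Proof. by apply/setP=> c; rewrite !inE /unfilled addn0 !if_same. Qed.

(** Fronts are looked for first, then plates; without either, every column of the window starts with
    a wall. The front case yields only the front, since its outer walls are forced only when
    [e = 0]. *)
Lemma tiling_cases P p y e : p + k <= m -> e < k -> y < n ->
    P \in tilings (is_brick k) (frontier p y e) ->
  [\/ y + e + k <= n /\ all (fun b => brick_set m n k b \in P) (wall_layer p y e),
      exists q, [/\ q + k <= m, 0 < e -> q = p, y + e + k <= n
        & all (fun b => brick_set m n k b \in P) (plate_layer q y e)]
    | exists q, [/\ q + k <= m, 0 < e -> q = p & brick_set m n k (BrickF q y) \in P]].
Proof.
move=> pm ek yn tP.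
have [/existsP[q Fq]|noF] :=
    boolP [exists q : 'I_m, [&& q + k <= m, (0 < e) ==> (q == p :> nat)
      & brick_set m n k (BrickF q y) \in P]].
  case/and3P: Fq => qm /implyP qp PF; apply: Or33; exists q; split=> //.
  by move/qp/eqP.
have [/existsP[q /existsP[z /and4P[qm /implyP qp PH yk]]]|noH] :=
    boolP [exists q : 'I_m, [exists z : 'I_k, [&& q + k <= m, (0 < e) ==> (q == p :> nat),
      brick_set m n k (BrickH q y z) \in P & y + k <= n]]].
  have tPq : P \in tilings (is_brick k) (frontier q y e).
    by case: posnP qp tP => [-> _ | _ /(_ isT)/eqP->] //; rewrite (frontier_0 p q).
  have [//|le_n plates] := tiling_plates qm ek tPq _ yk PH.
  by apply: Or32; exists q; split=> // /qp/eqP.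
have walls x : p <= x < p + k -> brick_set m n k (BrickW x y) \in P /\ y + k <= n.
  move=> px; have [//|[q [PF qx qm qp]]|[q [PH qx qm yk qp]]] :=
    unfilled_slice_brick pm ek tP px yn k_gt0.
    have qm' : q < m by lia.
    case/existsP: noF; exists (Ordinal qm') => /=; rewrite qm PF andbT /=.
    by apply/implyP=> /qp->.
  have qm' : q < m by lia.
  case/existsP: noH; exists (Ordinal qm'); apply/existsP; exists (Ordinal k_gt0) => /=.
  by rewrite qm PH yk !andbT /=; apply/implyP=> /qp->.
have [|_ yk] := walls p; first by lia.
have [|le_n all_walls] := tiling_walls pm ek tP yn _ yk; first by move=> x /walls[].
by apply: Or31.
Qed.

End Frontier.

(** * Cell multiplicities of the layers and recurrences for the number of tilings *)

Lemma count_iota_eq (a : nat) (c : bool) i j :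
  count (fun x => c && (a == x)) (iota i j) = c && (i <= a < i + j).
Proof.
case: c => /=; last by rewrite count_pred0.
rewrite (eq_count (a2 := pred1 a)) => [|x /=]; last by rewrite eq_sym.
by rewrite count_uniq_mem ?iota_uniq // mem_iota.
Qed.

Section Layers.

Variables m n k : nat.
Hypotheses (k_gt1 : 1 < k) (lt_km : k < m) (lt_m2k : m < 2 * k).

Let k_gt0 : 0 < k := ltnW k_gt1.

Notation bricks := (map (brick_set m n k)).
Notation mult c := (count (fun B : {set cell m n k} => c \in B)).

Lemma mult_outer_walls (c : cell m n k) p y :
  mult c (bricks (outer_walls m k p y)) = ~~ (p <= c.1.1 < p + k) && (y <= c.1.2 < y + k).
Proof.
rewrite /outer_walls !count_map count_filter.
rewrite (eq_count (a2 := fun x => (~~ (p <= c.1.1 < p + k) && (y <= c.1.2 < y + k))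
    && (nat_of_ord c.1.1 == x))).
  rewrite count_iota_eq; case: c => [[[x ?] y'] z] /=; lia.
move=> x /=; rewrite inE /=; case: eqP => [->|] /=; last by rewrite andbF.
by rewrite andbT andbC.
Qed.

Lemma mult_wall_layer (c : cell m n k) p y e : p + k <= m ->
  (c \in frontier m n k p y e : nat) =
    (c \in frontier m n k p (y + k) e) + mult c (bricks (wall_layer m k p y e)).
Proof.
move=> pm; rewrite /wall_layer map_cat count_cat mult_outer_walls !count_map.
rewrite (eq_count (a2 := fun x => (y <= c.1.2 < y + k) && (nat_of_ord c.1.1 == x))).
  by rewrite count_iota_eq !inE /unfilled; case: ifP; lia.
by move=> x /=; rewrite inE /= andbC.
Qed.

Lemma mult_plate_layer (c : cell m n k) p y e : p + k <= m ->
  (c \in frontier m n k p y e : nat) =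
    (c \in frontier m n k p (y + k) e) + mult c (bricks (plate_layer m k p y e)).
Proof.
move=> pm; rewrite /plate_layer map_cat count_cat mult_outer_walls !count_map.
rewrite (eq_count (a2 := fun z => ((p <= c.1.1 < p + k) && (y <= c.1.2 < y + k))
    && (nat_of_ord c.2 == z))).
  rewrite count_iota_eq !inE /unfilled; case: c => [[x y'] [z ?]] /=.
  by case: ifP; lia.
by move=> x /=; rewrite inE /= andbA.
Qed.

Lemma mult_front (c : cell m n k) p y e :
  (c \in frontier m n k p y e.+1 : nat) =
    (c \in frontier m n k p y.+1 e) + mult c (bricks [:: BrickF p y]).
Proof. by rewrite /= !inE /unfilled /= addn0; case: ifP; lia. Qed.

(** Outside the window the level becomes [y + k], which is [y.+1 + k.-1]; hence the new excess
    [k.-1]. *)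
Lemma mult_front_layer (c : cell m n k) p y :
  (c \in frontier m n k p y 0 : nat) =
    (c \in frontier m n k p y.+1 k.-1) + mult c (bricks (front_layer m k p y)).
Proof.
rewrite /front_layer map_cons [mult c _]/= mult_outer_walls !inE /unfilled /=.
by case: ifP; lia.
Qed.

Lemma all_brick (Q : seq brick) : all (fits_brick m n k) Q ->
  all (is_brick k) (bricks Q).
Proof.
elim: Q => //= b Q IHQ /andP[fb fQ]; rewrite IHQ // andbT.
by apply/is_brickP => //; exists b.
Qed.

Lemma fits_outer_walls p y : y + k <= n -> all (fits_brick m n k) (outer_walls m k p y).
Proof. by move=> yn; apply: all_outer_walls => x xm _ /=; rewrite xm. Qed.

Lemma fits_wall_layer p y e : p + k <= m -> y + e + k <= n ->
  all (fits_brick m n k) (wall_layer m k p y e).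
Proof.
move=> pm yn; rewrite all_cat fits_outer_walls // andbT all_map.
by apply/allP=> x; rewrite mem_iota /=; lia.
Qed.

Lemma fits_plate_layer p y e : p + k <= m -> y + e + k <= n ->
  all (fits_brick m n k) (plate_layer m k p y e).
Proof.
move=> pm yn; rewrite all_cat fits_outer_walls // andbT all_map.
by apply/allP=> x; rewrite mem_iota /=; lia.
Qed.

Lemma fits_front_layer p y : p + k <= m -> y + k <= n ->
  all (fits_brick m n k) (front_layer m k p y).
Proof. by move=> pm yn; rewrite /= fits_outer_walls // andbT; lia. Qed.

Lemma brick_set_eq b b' x y z : brick_set m n k b = brick_set m n k b' ->
  x < m -> y < n -> z < k -> in_brick k b x y z = in_brick k b' x y z.
Proof.
move=> /setP E xm yn zk; have [c [cx cy cz]] := cellP xm yn zk.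
by have := E c; rewrite !inE cx cy cz.
Qed.

Lemma sub_bricks (P : {set {set cell m n k}}) Q :
  all (fun b => brick_set m n k b \in P) Q -> {subset bricks Q <= P}.
Proof. by rewrite -(all_map (brick_set m n k) (mem P)) => /allP. Qed.

Notation count_frontier p y e := #|tilings (is_brick k) (frontier m n k p y e)|.

Lemma wall_in_layer p y e x : p <= x < p + k ->
  brick_set m n k (BrickW x y) \in bricks (wall_layer m k p y e).
Proof.
move=> px; rewrite map_cat mem_cat -map_comp; apply/orP; left.
by apply/mapP; exists x; rewrite ?mem_iota.
Qed.

Lemma plate_in_layer p y e :
  brick_set m n k (BrickH p y 0) \in bricks (plate_layer m k p y e).
Proof.
rewrite map_cat mem_cat -map_comp; apply/orP; left.
by apply/mapP; exists 0; rewrite ?mem_iota.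
Qed.

(** The relation (1 - 2t) T_(e+1) = T_e on counts. Only the wall and plate layers need [k] further
    slices outside, hence the condition on the second term. *)
Lemma card_frontierS p y e : p + k <= m -> e.+1 < k -> y + e.+1 <= n ->
  count_frontier p y e.+1 = count_frontier p y.+1 e +
    (if y + e.+1 + k <= n then 2 * count_frontier p (y + k) e.+1 else 0).
Proof.
move=> pm ek yn.
have [|||c [cx cy cz]] := @cellP m n k p y 0; try lia.
pose hd (i : option bool) := if i is Some b then
  if b then BrickF p y else BrickH p y 0 else BrickW p y.
pose Q (i : option bool) := if i is Some b then
  if b then [:: BrickF p y] else plate_layer m k p y e.+1 else wall_layer m k p y e.+1.
pose D' (i : option bool) := if i is Some true then frontier m n k p y.+1 e
  else frontier m n k p (y + k) e.+1.
rewrite (@card_tilings_split _ (is_brick k) _ _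
  (fun i => (i == Some true) || (y + e.+1 + k <= n))
  (fun i => bricks (Q i)) D' (fun i => brick_set m n k (hd i)) c).
- rewrite big_mkcond /= (bigD1 (Some true)) //= (bigD1 (Some false)) //= (bigD1 None) //=.
  rewrite big1 => [|[[]|] //]; case: ifP; lia.
- exact: is_brick0.
(* Column [p.+1] tells the wall from the other two bricks, and height 1 tells the plate from the
   front. *)
- move=> i j _ _ /brick_set_eq E; have := E p.+1 y 0; have := E p y 1.
  by case: i j {E} => [[]|] [[]|] //=; lia.
- case=> [[]|] _ /=; [exact: mem_head | exact: plate_in_layer |].
  by apply: wall_in_layer; lia.
- by case=> [[]|] _; rewrite inE /= cx cy ?cz; lia.
- move=> i fi; apply: all_brick; case: i fi => [[]|] /= yk.
  + by rewrite /=; lia.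
  + exact: fits_plate_layer.
  exact: fits_wall_layer.
- move=> [[]|] /= yk c'; [exact: mult_front | exact: mult_plate_layer |].
  exact: mult_wall_layer.
move=> P tP; have [||[yk /sub_bricks sP]|[q [_  /(_ isT)-> yk /sub_bricks sP]]|] :=
  tiling_cases k_gt1 lt_km lt_m2k pm _ _ tP; try lia.
- by exists None.
- by exists (Some false).
case=> q [_ /(_ isT)-> PF]; exists (Some true) => // B.
by rewrite mem_seq1 => /eqP->.
Qed.

(** The relation for T_0: one layer of walls only, or one of the [m - k + 1] windows filled with
    plates or a front. *)
Lemma card_frontier0 y : y < n ->
  count_frontier 0 y 0 =
    if y + k <= n then
      count_frontier 0 (y + k) 0
      + \sum_(q < (m - k).+1) (count_frontier q (y + k) 0 + count_frontier q y.+1 k.-1)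
    else 0.
Proof.
(* Column [m - k] belongs to every window, because [m - k < k]; so one cell serves all
   alternatives. *)
move=> yn; have [|||c [cx cy cz]] := @cellP m n k (m - k) y 0; try lia.
pose I := (unit + ('I_(m - k).+1 + 'I_(m - k).+1))%type.
pose hd (i : I) := match i with
  | inl _ => BrickW (m - k) y | inr (inl q) => BrickH q y 0 | inr (inr q) => BrickF q y end.
pose Q (i : I) := match i with
  | inl _ => wall_layer m k 0 y 0
  | inr (inl q) => plate_layer m k q y 0 | inr (inr q) => front_layer m k q y end.
pose D' (i : I) := match i with
  | inl _ => frontier m n k 0 (y + k) 0
  | inr (inl q) => frontier m n k q (y + k) 0 | inr (inr q) => frontier m n k q y.+1 k.-1 end.
have qm (q : 'I_(m - k).+1) : q + k <= m by case: q => q /=; lia.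
rewrite (@card_tilings_split _ (is_brick k) _ _ (fun i => y + k <= n)
  (fun i => bricks (Q i)) D' (fun i => brick_set m n k (hd i)) c).
- case: ifP => _; last by rewrite big_pred0.
  rewrite !big_sumType /= big_split /=; congr (_ + _).
  by rewrite big_const card_unit /= addn0.
- exact: is_brick0.
- move=> i j _ _ /brick_set_eq E.
  have e1 x := E x y 0; have e2 x := E x y 1.
  case: i j {E} e1 e2 => [[]|[] [q ?]] [[]|[] [q' ?]] /= e1 e2 //.
  + by have := e1 q'; have := e1 q'.+1; lia.
  + by have := e1 q'; have := e1 q'.+1; lia.
  + by have := e1 q; have := e1 q.+1; lia.
  + by congr (inr (inl _)); apply: val_inj => /=; have := e1 q; have := e1 q'; lia.
  + by have := e1 q; have := e2 q; lia.
  + by have := e1 q; have := e1 q.+1; lia.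
  + by have := e1 q; have := e2 q; have := e2 q'; lia.
  by congr (inr (inr _)); apply: val_inj => /=; have := e1 q; have := e1 q'; lia.
- case=> [[]|[] q] _ /=; [ | exact: plate_in_layer | exact: mem_head].
  by apply: wall_in_layer; lia.
- by case=> [[]|[] [q ?]] _; rewrite inE /= cx cy ?cz; lia.
- move=> i fi; apply: all_brick; case: i fi => [[]|[] q] yk.
  + by apply: fits_wall_layer; lia.
  + by apply: fits_plate_layer; rewrite ?addn0.
  exact: fits_front_layer.
- case=> [[]|[] q] /= yk c'.
  + by apply: mult_wall_layer; lia.
  + by rewrite (frontier_0 _ _ _ 0 q); apply: mult_plate_layer.
  by rewrite (frontier_0 _ _ _ 0 q); apply: mult_front_layer.
move=> P tP.
have [||[yk /sub_bricks sP]|[q [qk _ yk /sub_bricks sP]]|] :=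
  tiling_cases k_gt1 lt_km lt_m2k _ _ yn tP; try lia.
- by exists (inl tt); rewrite // -(addn0 y).
- have qs : q < (m - k).+1 by lia.
  by exists (inr (inl (Ordinal qs))); rewrite // -(addn0 y).
(* With excess 0 the window may be renamed [q], and the front there forces its outer walls. *)
case=> q [qk _ PF]; rewrite (frontier_0 _ _ _ 0 q) in tP.
have [|yk /sub_bricks sP] := tiling_fronts k_gt1 lt_km lt_m2k qk _ tP (erefl _) yn PF; first lia.
have qs : q < (m - k).+1 by lia.
by exists (inr (inr (Ordinal qs))).
Qed.

End Layers.

(** * Generating functions *)

Local Open Scope ring_scope.

(** Truncating [f] to a polynomial lets the ring laws of polynomials be used for series. *)
Lemma fps_mul_polyE (R : comUnitRingType) (p : {poly R}) (f : fps R) N n :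
  (n < N)%N -> fps_mul (fps_poly p) f n = (p * \poly_(i < N) f i)`_n.
Proof.
move=> nN; rewrite coefM; apply: eq_bigr => i _.
by rewrite coef_poly (leq_ltn_trans (leq_subr _ _) nN).
Qed.

Lemma fps_mul_polyD (R : comUnitRingType) (p q : {poly R}) (f : fps R) n :
  fps_mul (fps_poly (p + q)) f n = fps_mul (fps_poly p) f n + fps_mul (fps_poly q) f n.
Proof. by rewrite !(fps_mul_polyE _ _ (ltnSn n)) mulrDl coefD. Qed.

Lemma fps_mul_polyZXn (R : comUnitRingType) (a : R) k (p : {poly R}) (f : fps R) n :
  fps_mul (fps_poly (a *: ('X^k * p))) f n =
    if (k <= n)%N then a * fps_mul (fps_poly p) f (n - k)%N else 0.
Proof.
rewrite (fps_mul_polyE _ _ (ltnSn n)) -scalerAl -mulrA coefZ coefXnM ltnNge.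
case: leqP => _; last by rewrite mulr0.
by rewrite (@fps_mul_polyE _ _ _ n.+1) // ltnS leq_subr.
Qed.

Section Series.

Variables (k s : nat).
Hypothesis k_gt0 : (0 < k)%N.

(** The denominator of the theorem for s = m - k, obtained by eliminating T_(k-1) = T_0 / (1 -
    2t)^(k-1) from the relation for T_0. *)
Definition series_den : {poly int} :=
  (1 - 2%:Z *: 'X^k) ^+ (k - 1)%N * (1 - (s%:Z + 2) *: 'X^k) - (s%:Z + 1) *: 'X^k.

(* T_e = T_0 / (1 - 2t)^e, and the numerator of T_0 is (1 - 2t)^(k-1). *)
Definition state_series (e : nat) : fps int :=
  fps_div (fps_poly ((1 - 2%:Z *: 'X^k) ^+ (k - 1 - e)%N)) (fps_poly series_den).

Lemma state_seriesS e l : (e.+1 < k)%N ->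
  state_series e.+1 l = state_series e l
    + (if (k <= l)%N then 2%:Z * state_series e.+1 (l - k)%N else 0).
Proof.
move=> ek; rewrite /state_series /fps_div -fps_mul_polyZXn -fps_mul_polyD.
have -> : (k - 1 - e = (k - 1 - e.+1).+1)%N by lia.
congr (fps_mul (fps_poly _) _ l); rewrite exprS mulrBl mul1r.
by rewrite -scalerAl subrK.
Qed.

Lemma state_series0 l :
  state_series 0 l = (l == 0%N)%:R
    + (if (k <= l)%N then (s%:Z + 2) * state_series 0 (l - k)%N else 0)
    + (if (k <= l)%N then (s%:Z + 1) * state_series k.-1 (l - k)%N else 0).
Proof.
rewrite /state_series /fps_div subn0 subn1 subnn expr0 -!fps_mul_polyZXn.
(* The series 1 is written as the denominator times its inverse, so that all terms share this
   inverse and a polynomial identity of numerators remains. *)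
have <- : fps_mul (fps_poly series_den) (fps_inv (fps_poly series_den)) l = (l == 0%N)%:R.
  rewrite fps_mulfV; first by rewrite /fps_poly coef1.
  rewrite /fps_poly /series_den -horner_coef0 !hornerE /=.
  rewrite !expr0n (gtn_eqF k_gt0) /= !mulr0 !subr0 !expr1n mul1r unitr1 //.
rewrite -!fps_mul_polyD; congr (fps_mul (fps_poly _) _ l).
rewrite /series_den subn1 -!mul_polyC; ring.
Qed.

End Series.

(** * Comparison of the counts with the coefficients *)

(** Both sides obey the same recurrences. The index is the number of slices left outside the window:
    a front with [e > 0] leaves it unchanged, every other move lowers it by [k]. *)
Lemma card_frontier m n k p y e :
    (1 < k)%N -> (k < m)%N -> (m < 2 * k)%N ->
    (p + k <= m)%N -> (e < k)%N -> (y + e <= n)%N ->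
  #|tilings (is_brick k) (frontier m n k p y e)|%:Z = state_series k (m - k) e (n - y - e)%N.
Proof.
move=> k_gt1 lt_km lt_m2k.
have k_gt0 : (0 < k)%N by lia.
(* Induction on [n - y], since every move, a front included, raises [y]. *)
have [l] := ubnP (n - y); elim: l => // l IHl in p y e *; rewrite ltnS => le_l pm ek yen.
case: e => [|e] in ek yen *; last first.
  rewrite card_frontierS // state_seriesS // PoszD IHl; try lia.
  have -> : (n - y.+1 - e = n - y - e.+1)%N by lia.
  congr (_ + _); have -> : (k <= n - y - e.+1)%N = (y + e.+1 + k <= n)%N by lia.
  case: ifP => // yk; rewrite PoszM IHl; try lia.
  by congr (_ * state_series _ _ _ _); lia.
rewrite (frontier_0 _ _ _ p 0) state_series0 // subn0 subn_eq0.
have [ny|yn] := leqP n y.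
  have -> : frontier m n k 0 y 0 = set0.
    by apply/setP=> -[[x [y' ?]] z]; rewrite !inE /unfilled /=; case: ifP; lia.
  by rewrite card_tilings0; case: ifP => [|_]; [lia | rewrite !addr0].
rewrite card_frontier0 // add0r; have -> : (k <= n - y)%N = (y + k <= n)%N by lia.
case: ifP => // yk; rewrite PoszD IHl; try lia.
rewrite subn0 -subnDA (big_morph Posz PoszD (erefl _)).
(* All [m - k + 1] windows contribute equally; the layer of walls only raises the coefficient of T_0
   to [m - k + 2]. *)
rewrite (eq_bigr (fun=> state_series k (m - k) 0 (n - (y + k))%N
    + state_series k (m - k) k.-1 (n - (y + k))%N)) => [|[q qs] _].
  by rewrite sumr_const card_ord -mulr_natl -natr1 natz; ring.
rewrite PoszD /= !IHl; try lia.
by rewrite subn0; congr (_ + state_series _ _ _ _); lia.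
Qed.

Theorem theorem3p3 (k m : nat) (k_gt0 : (0 < k)%N) (m_gt0 : (0 < m)%N)
    (lt_km : (k < m)%N) (lt_m2k : (m < 2 * k)%N) :
  (fun n : nat => (hbar k m n)%:Z) =1
  fps_div
    (fps_poly ((1 - 2%:Z *: 'X^k) ^+ (k - 1)%N))
    (fps_poly ((1 - 2%:Z *: 'X^k) ^+ (k - 1)%N
                 * (1 - (m%:Z - k%:Z + 2) *: 'X^k)
               - (m%:Z - k%:Z + 1) *: 'X^k)).
(* The case [k = 1] is excluded by [k < m < 2 * k]. *)
move=> n; have k_gt1 : (1 < k)%N by lia.
have -> : hbar k m n = #|tilings (is_brick k) (frontier m n k 0 0 0)|.
  apply: eq_card => P; rewrite !inE; congr (partition P _ && _).
  by apply/setP=> c; rewrite !inE /unfilled if_same.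
rewrite card_frontier ?add0n ?(ltnW lt_km) // !subn0 /state_series subn0 /series_den.
by rewrite -subzn // ltnW.
Qed.
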